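(* Let $L$ be an infinite locally compact Hausdorff space, and consider $\ell_1$ and $C_0(L)$ over the same scalar field $\mathbb{K}$, where $\mathbb{K}=\mathbb{R}$ or $\mathbb{C}$. Then the pair $(\ell_1,C_0(L))$ does not have the BPBZp. In particular, neither $\ell_1\oplus_1 C_0(L)$ nor $\ell_1\oplus_\infty C_0(L)$ has the BPBp-nu.
   Context: $S_X$ is the unit sphere of a Banach space $X$, $X^*$ its topological dual, $\mathcal{L}(X,Y)$ the bounded linear operators from $X$ to $Y$, $\mathcal{L}(X)=\mathcal{L}(X,X)$. $C_0(L)$ is the space of $\mathbb{K}$-valued continuous functions on $L$ vanishing at infinity, with the supremum norm. $X\oplus_1 Y$ and $X\oplus_\infty Y$ denote $X\times Y$ with norms $\|x\|+\|y\|$ and $\max\{\|x\|,\|y\|\}$ respectively. BPBZp (Bishop-Phelps-Bollobás-Zizler property): a pair $(X,Y)$ of Banach spaces has the BPBZp if for every $\varepsilon>0$ there exists $\eta(\varepsilon)>0$ such that whenever $T\in\mathcal{L}(X,Y)$ with $\|T\|=1$, $y_0^*\in S_{Y^*}$ and $x_0\in S_X$ satisfy $|y_0^*(Tx_0)|>1-\eta(\varepsilon)$, there exist $y_1^*\in S_{Y^*}$, $x_1\in S_X$ and $S\in\mathcal{L}(X,Y)$ with $\|S\|=|y_1^*(Sx_1)|=1$, $\|x_1-x_0\|<\varepsilon$, $\|y_1^*-y_0^*\|<\varepsilon$ and $\|S-T\|<\varepsilon$. Let $\Pi(X)=\{(x,x^* )\in S_X\times S_{X^*}: x^*(x)=1\}$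 and $\nu(T)=\sup\{|x^*(Tx)|:(x,x^* )\in\Pi(X)\}$ for $T\in\mathcal{L}(X)$. BPBp-nu: $X$ has the BPBp-nu if for every $0<\varepsilon<1$ there exists $\eta(\varepsilon)>0$ such that whenever $T\in\mathcal{L}(X)$ and $(x_0,x_0^* )\in\Pi(X)$ satisfy $\nu(T)=1$ and $|x_0^*(Tx_0)|>1-\eta(\varepsilon)$, there exist $S\in\mathcal{L}(X)$ and $(x_1,x_1^* )\in\Pi(X)$ such that $\nu(S)=|x_1^*(Sx_1)|=1$, $\|S-T\|<\varepsilon$, $\|x_1-x_0\|<\varepsilon$ and $\|x_1^*-x_0^*\|<\varepsilon$. *)

(* Defs.v *)
From HB Require Import structures.
From mathcomp Require Import all_boot all_order all_algebra.
From mathcomp Require Import all_classical all_reals all_analysis.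
From mathcomp Require Import complex.

Set Implicit Arguments.
Unset Strict Implicit.
Unset Printing Implicit Defensive.

Import Order.TTheory GRing.Theory Num.Theory.
Import numFieldNormedType.Exports.

Local Open Scope classical_set_scope.
Local Open Scope ring_scope.
Local Open Scope complex_scope.

Variant scalar_kind := RealScalars | ComplexScalars.

Definition RorC (R : realType) (k : scalar_kind) : numFieldType :=
  match k with
  | RealScalars => R
  | ComplexScalars => R[i]
  end.

(* In a normedModType K the norm takes its values in K itself.  When K is
   complex, 0 <= x forces x to be real and two elements are comparable only if
   their imaginary parts agree, so [0 < e] quantifies over positive reals and
   the supremum of a nonempty bounded set of norms, taken in the poset K, is
   its supremum as a set of reals. *)

Lemma RorC_lub (R : realType) (k : scalar_kind) (A : set (RorC R k)) :
  A !=set0 -> (forall x, A x -> 0 <= x) -> has_ubound A ->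
  exists s, isLub A s.
Proof.
case: k A => A [a Aa] A0 [M AM].
- have hA : has_sup (A : set R) by split; [exists a | exists M].
  exists (sup (A : set R)); split; first exact/ubP/(sup_upper_bound hA).
  by move=> b Ab; apply: ge_sup; [exists a|].
- have imA x : A x -> complex.Im x = 0.
    by move=> /A0; case: x => r i; rewrite lecE /= => /andP[/eqP].
  have reAM b : ubound A b -> ubound (@complex.Re R @` A) (complex.Re b).
    by move=> Ab _ [x Ax <-]; have := Ab _ Ax; rewrite lecE => /andP[].
  have hA : has_sup (@complex.Re R @` A).
    by split; [exists (complex.Re a), a | exists (complex.Re M); exact: reAM].
  exists (sup (@complex.Re R @` A))%:C; split.
    move=> x Ax; rewrite lecE /= (imA _ Ax) eqxx /=.
    by apply: (sup_upper_bound hA); exists x.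
  move=> b Ab; rewrite lecE /=; apply/andP; split.
    by have := Ab _ Aa; rewrite lecE (imA _ Aa) => /andP[].
  by apply: ge_sup; [exists (complex.Re a), a | exact: reAM].
Qed.

Section bounded_operators.
Context {K : numFieldType}.
Implicit Types X Y : normedModType K.

Definition unit_sphere X : set X := [set x | `|x| = 1].

(* Meaningful for bounded operators only: [supremum] defaults to its first
   argument on sets that are empty or have no supremum. *)
Definition opnorm X Y (f : X -> Y) : K :=
  supremum 0 [set `|f x| | x in [set x | `|x| <= 1]].

Definition bounded_operators X Y : set {linear X -> Y} :=
  [set T | continuous T].

(* S_{X^*}, the functionals being the operators into K^o, i.e. K seen as a
   normed space over itself. *)
Definition dual_unit_sphere X : set {linear X -> K^o} :=
  [set f | bounded_operators f /\ opnorm f = 1].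

Definition BPBZp X Y : Prop :=
  forall e : K, 0 < e -> exists2 eta : K, 0 < eta &
    forall (T : {linear X -> Y}) (y0 : {linear Y -> K^o}) (x0 : X),
      bounded_operators T -> opnorm T = 1 ->
      dual_unit_sphere y0 -> unit_sphere x0 ->
      1 - eta < `|y0 (T x0)| ->
    exists (y1 : {linear Y -> K^o}) (x1 : X) (S : {linear X -> Y}),
      [/\ dual_unit_sphere y1, unit_sphere x1 & bounded_operators S] /\
      [/\ opnorm S = 1, `|y1 (S x1)| = 1,
          `|x1 - x0| < e, opnorm (y1 \- y0) < e & opnorm (S \- T) < e].

Definition states X : set (X * {linear X -> K^o}) :=
  [set p | [/\ unit_sphere p.1, dual_unit_sphere p.2 & p.2 p.1 = 1]].

Definition numerical_radius X (T : X -> X) : K :=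
  supremum 0 [set `|p.2 (T p.1)| | p in @states X].

Definition BPBp_nu X : Prop :=
  forall e : K, 0 < e -> e < 1 -> exists2 eta : K, 0 < eta &
    forall (T : {linear X -> X}) (x0 : X) (x0' : {linear X -> K^o}),
      bounded_operators T -> states (x0, x0') ->
      numerical_radius T = 1 -> 1 - eta < `|x0' (T x0)| ->
    exists (S : {linear X -> X}) (x1 : X) (x1' : {linear X -> K^o}),
      [/\ bounded_operators S, states (x1, x1'),
          numerical_radius S = 1 & `|x1' (S x1)| = 1] /\
      [/\ opnorm (S \- T) < e, `|x1 - x0| < e & opnorm (x1' \- x0') < e].

End bounded_operators.

(* X (+)_1 Y.  The product type X * Y carries the maximum norm in the library
   and thus is X (+)_oo Y. *)
Definition sum1 (X Y : Type) : Type := (X * Y)%type.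

Section sum1_normed.
Context {K : numFieldType} {X Y : normedModType K}.

HB.instance Definition _ := GRing.Lmodule.copy (sum1 X Y) (X * Y)%type.

Definition sum1_norm (p : sum1 X Y) : K := `|p.1| + `|p.2|.

Let sum1_normD p q : sum1_norm (p + q) <= sum1_norm p + sum1_norm q.
Proof. by rewrite /sum1_norm addrACA lerD// ler_normD. Qed.

Let sum1_normZ (l : K) p : sum1_norm (l *: p) = `|l| * sum1_norm p.
Proof. by rewrite /sum1_norm mulrDr -!normrZ. Qed.

Let sum1_norm0_eq0 p : sum1_norm p = 0 -> p = 0.
Proof.
case: p => x y /eqP; rewrite /sum1_norm paddr_eq0//= !normr_eq0.
by case/andP=> /eqP -> /eqP ->.
Qed.

HB.instance Definition _ :=
  Lmodule_isNormed.Build K (sum1 X Y) sum1_normD sum1_normZ sum1_norm0_eq0.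

End sum1_normed.

Section C0.
Context {R : realType} {k : scalar_kind} {L : topologicalType}.
Local Notation K := (RorC R k).

Definition vanishing_continuous : {pred L -> K} :=
  [pred f : L -> K | `[< continuous f /\
    forall e : K, 0 < e -> compact [set x | e <= `|f x|] >]].

Let closed_ge (f : L -> K) (e : K) : 0 < e -> continuous f ->
  closed [set x | e <= `|f x|].
Proof.
move=> e0 cf; rewrite (_ : [set _ | _] = f @^-1` (~` ball (0 : K) e)).
  by apply: preimage_closed => [x _|]; [exact: cf|exact/open_closedC/ball_open].
apply/seteqP; split=> x /=; rewrite -ball_normE /= sub0r normrN.
  by move=> ef /(le_lt_trans ef); rewrite ltxx.
by move/negP; rewrite real_ltNge ?negbK// gtr0_real.
Qed.

Let submod : submod_closed vanishing_continuous.
Proof.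
split.
  apply/asboolP; split; first exact: cst_continuous.
  move=> e e0; rewrite (_ : [set _ | _] = set0); first exact: compact0.
  apply/seteqP; split=> x //=; rewrite normr0 => /(lt_le_trans e0).
  by rewrite ltxx.
move=> a f g /asboolP[cf vf] /asboolP[cg vg]; apply/asboolP.
have cfg : continuous (a *: f + g).
  move=> x; apply: cvgD; last exact: cg.
  by apply: cvgM; [exact: cvg_cst|exact: cf].
split=> // e e0.
have e20 : 0 < e / 2 by rewrite divr_gt0.
have a0 : 0 < `|a| + 1 by rewrite ltr_wpDl.
have e2a0 : 0 < e / 2 / (`|a| + 1) by rewrite divr_gt0.
apply: (subclosed_compact (closed_ge e0 cfg) (compactU (vf _ e2a0) (vg _ e20))).
move=> x /= efg; apply: contrapT => /not_orP[/negP + /negP].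
rewrite -!real_ltNge ?normr_real ?(gtr0_real e20) ?(gtr0_real e2a0)// => fx gx.
suff : `|a * f x + g x| < e by move=> /(le_lt_trans efg); rewrite ltxx.
rewrite (le_lt_trans (ler_normD _ _))// [ltRHS](splitr e) ler_ltD// normrM.
rewrite (@le_trans _ _ ((`|a| + 1) * `|f x|)) ?ler_wpM2r ?lerDl//.
by rewrite mulrC -ler_pdivlMr// ltW.
Qed.

HB.instance Definition _ :=
  GRing.isSubmodClosed.Build K (L -> K) vanishing_continuous submod.

Record C0 := MkC0 { C0_fun :> L -> K ; _ : C0_fun \in vanishing_continuous }.

HB.instance Definition _ := [isSub for C0_fun].
HB.instance Definition _ := [Choice of C0 by <:].
HB.instance Definition _ := [SubChoice_isSubLmodule of C0 by <:].

Definition C0_norm (f : C0) : K := supremum 0 (range (fun x => `|f x|)).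

Let C0_bounded (f : C0) : has_ubound (range (fun x => `|f x|)).
Proof.
case: f => f /= /asboolP[cf vf].
suff [N N1 fN] : exists2 N : K, 1 <= N &
    [set x | 1 <= `|f x|] `<=` [set x | `|f x| <= N].
  exists N => _ [x _ <-].
  have [fx1|fx1] := real_leP (real1 K) (normr_real (f x)); first exact: fN.
  by rewrite (le_trans (ltW fx1)).
have /compact_near_coveringP/(_ K +oo (fun N x => `|f x| <= N)) := vf _ ltr01.
case=> [x _|N [Nr fN]].
  exists ([set y | `|f x - f y| < 1], [set N | `|f x| + 1 < N]) => /=.
    split; first by move/cvgrPdist_lt : (cf x); apply.
    by apply: nbhs_pinfty_gt; rewrite realD.
  move=> [y M] /= [fxy /ltW]; apply: le_trans.
  by rewrite -lerBlDl (le_trans (lerB_dist _ _))// distrC ltW.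
exists (`|N| + 1); first by rewrite lerDr.
apply: fN; rewrite (le_lt_trans (real_ler_norm Nr))// ltrDl//.
Qed.

Let C0_normP (f : C0) (x0 : L) :
  isLub (range (fun x => `|f x|)) (C0_norm f).
Proof.
have [||s ls] := @RorC_lub R k (range (fun x => `|f x|)) _ _ (C0_bounded f).
- by exists `|f x0|, x0.
- by move=> _ [x _ <-].
rewrite /C0_norm /supremum ifF; last first.
  by apply/eqP => /seteqP[/(_ `|f x0|) + _]; apply; exists x0.
by case: xgetP => [y _ //|/(_ s)].
Qed.

Let C0_norm_empty (f : C0) : (L -> False) -> C0_norm f = 0.
Proof.
move=> L0; rewrite /C0_norm (_ : range (fun x => `|f x|) = set0) ?supremum0//.
by apply/seteqP; split=> // y [x]; have := L0 x.
Qed.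

Let C0_normD f g : C0_norm (f + g) <= C0_norm f + C0_norm g.
Proof.
have [[x0]|L0] := pselect (inhabited L); last first.
  by rewrite !C0_norm_empty ?addr0// => x; apply: L0.
have [_] := C0_normP (f + g) x0; apply=> _ [x _ <-].
rewrite (le_trans (ler_normD _ _))// lerD//.
  by have [+ _] := C0_normP f x0; apply; exists x.
by have [+ _] := C0_normP g x0; apply; exists x.
Qed.

Let C0_normZ (l : K) f : C0_norm (l *: f) = `|l| * C0_norm f.
Proof.
have [[x0]|L0] := pselect (inhabited L); last first.
  by rewrite !C0_norm_empty ?mulr0// => x; apply: L0.
have [ubf lf] := C0_normP f x0; have [ublf llf] := C0_normP (l *: f) x0.
have lef : `|l| * C0_norm f >= C0_norm (l *: f).
  apply: llf => _ [x _ <-]; rewrite normrM ler_wpM2l//.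
  by apply: ubf; exists x.
apply/eqP; rewrite eq_le lef /=.
have [->|l0] := eqVneq l 0.
  rewrite normr0 mul0r (@le_trans _ _ `|(0 *: f) x0|)//.
  by have [+ _] := C0_normP (0 *: f) x0; apply; exists x0.
rewrite -ler_pdivlMl ?normr_gt0//; apply: lf => _ [x _ <-].
rewrite ler_pdivlMl ?normr_gt0// -normrM.
by apply: ublf; exists x.
Qed.

Let C0_norm0_eq0 f : C0_norm f = 0 -> f = 0.
Proof.
move=> f0; apply/val_inj/funext => x /=.
have [ubf _] := C0_normP f x.
apply/eqP; rewrite -normr_le0 -f0.
by apply: ubf; exists x.
Qed.

HB.instance Definition _ :=
  Lmodule_isNormed.Build K C0 C0_normD C0_normZ C0_norm0_eq0.

End C0.
Arguments C0 : clear implicits.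

Section l1.
Context {R : realType} {k : scalar_kind}.
Local Notation K := (RorC R k).

Definition summable : {pred nat -> K} :=
  [pred u : nat -> K | `[< cvgn (series (fun n => `|u n|)) >]].

Let nseries (u : nat -> K) := series (fun n => `|u n|).

Let nseries_ge0 u n : 0 <= nseries u n.
Proof. exact: sumr_ge0. Qed.

Let nseries_nd u m n : (m <= n)%N -> nseries u m <= nseries u n.
Proof.
by move=> mn; rewrite /nseries /series /= (@big_cat_nat _ _ _ m 0%N n)//= lerDl sumr_ge0.
Qed.

Let nseries_cvg u : has_ubound (range (nseries u)) ->
  cvgn (nseries u) /\ isLub (range (nseries u)) (limn (nseries u)).
Proof.
move=> ub; have [||s ls] := RorC_lub _ _ ub.
- by exists (nseries u 0), 0%N.
- by move=> _ [n _ <-].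
suff us : nseries u @ \oo --> s.
  by split; [apply/cvg_ex; exists s|rewrite (cvg_lim _ us)].
have us n : nseries u n <= s by apply: ls.1; exists n.
have s0 : 0 <= s := le_trans (nseries_ge0 u 0) (us 0%N).
apply/cvgrPdist_lt => e e0.
have [N uN] : exists N, s - e < nseries u N.
  apply: contrapT => /forallNP h.
  have : s <= s - e.
    apply: ls.2 => _ [n _ <-]; have /negP := h n.
    by rewrite -real_leNgt// ?realB// ?ger0_real// ltW.
  by rewrite lerDl oppr_ge0 => /(lt_le_trans e0); rewrite ltxx.
exists N => // n /= Nn; rewrite ger0_norm ?subr_ge0// ltrBlDl -ltrBlDr.
by rewrite (lt_le_trans uN)// nseries_nd.
Qed.

Let nseries_bounded u : cvgn (nseries u) -> has_ubound (range (nseries u)).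
Proof.
move=> /cvg_seq_bounded[M [Mr uM]].
exists (`|M| + 1) => _ [n _ <-].
rewrite -[leLHS]ger0_norm// uM//.
by rewrite (le_lt_trans (real_ler_norm Mr))// ltrDl.
Qed.

Let submod : submod_closed summable.
Proof.
split.
  apply/asboolP; apply: (nseries_cvg _).1; exists 0 => _ [n _ <-].
  by rewrite /nseries /series /= big1// => i _; rewrite normr0.
move=> a u v /asboolP/nseries_bounded[M uM] /asboolP/nseries_bounded[N vN].
apply/asboolP; apply: (nseries_cvg _).1; exists (`|a| * M + N) => _ [n _ <-].
apply: (@le_trans _ _ (`|a| * nseries u n + nseries v n)).
  rewrite /nseries /series /= big_distrr /= -big_split /= ler_sum// => i _.
  by rewrite (le_trans (ler_normD _ _))// normrM.
by rewrite lerD ?ler_wpM2l//; [apply: uM|apply: vN]; exists n.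
Qed.

HB.instance Definition _ :=
  GRing.isSubmodClosed.Build K (nat -> K) summable submod.

Record l1 := MkL1 { l1_fun :> nat -> K ; _ : l1_fun \in summable }.

HB.instance Definition _ := [isSub for l1_fun].
HB.instance Definition _ := [Choice of l1 by <:].
HB.instance Definition _ := [SubChoice_isSubLmodule of l1 by <:].

Definition l1_norm (u : l1) : K := limn (series (fun n => `|u n|)).

Let l1_normP (u : l1) : isLub (range (nseries u)) (l1_norm u).
Proof.
by apply: (nseries_cvg _).2; apply: nseries_bounded; case: u => w /= /asboolP.
Qed.

Let l1_normD u v : l1_norm (u + v) <= l1_norm u + l1_norm v.
Proof.
apply: (l1_normP (u + v)).2 => _ [n _ <-].
apply: (@le_trans _ _ (nseries u n + nseries v n)).
  rewrite /nseries /series /= -big_split /= ler_sum// => i _.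
  exact: ler_normD.
by rewrite lerD//; [apply: (l1_normP u).1|apply: (l1_normP v).1]; exists n.
Qed.

Let l1_normZ (l : K) u : l1_norm (l *: u) = `|l| * l1_norm u.
Proof.
have E n : nseries (l *: u) n = `|l| * nseries u n.
  rewrite /nseries /series /= big_distrr /=.
  by apply: eq_bigr => i _; exact: normrM.
rewrite /l1_norm.
rewrite (_ : series _ = fun n => `|l| * nseries u n); last exact/funext/E.
apply: cvg_lim => //; apply: cvgMr.
by case: (u) => w /= /asboolP.
Qed.

Let l1_norm0_eq0 u : l1_norm u = 0 -> u = 0.
Proof.
move=> u0; apply/val_inj/funext => n /=; apply/eqP; rewrite -normr_le0 -u0.
apply: (@le_trans _ _ (nseries u n.+1)).
  by rewrite /nseries /series /= big_nat_recr//= lerDr sumr_ge0.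
by apply: (l1_normP u).1; exists n.+1.
Qed.

HB.instance Definition _ :=
  Lmodule_isNormed.Build K l1 l1_normD l1_normZ l1_norm0_eq0.

End l1.
Arguments l1 : clear implicits.

(* Main.v *)
(* Fix bump functions g_1, ..., g_n >= 0 in C_0(L) with sum at most 1 and
   g_i(t_j) = delta_ij, and let T : l_1 -> C_0(L) map e_i to the sum of the g_j,
   j <> i, for i <= n (and to 0 for i > n).  At the averages x of the e_i and y
   of the evaluations at the t_j, y(T x) = 1 - 1/n.  Suppose that S, x', y' are
   close to T, x, y and that |y'(S x')| = |S| = 1.  By convexity |y'(S e_i)| = 1
   whenever x'_i <> 0, so y' vanishes at h_i = g_i (1 - |S e_i|) because
   |S e_i + c h_i| <= 1 for |c| = 1.  But h_i(t_i) is close to 1, since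
   (T e_i)(t_i) = 0, and x'_i <> 0 for most i; hence y is almost 1 at the sum of
   these h_i, where y' is 0.

   For the direct sums the same argument applies to (x, y) |-> (0, T x).  There
   the numerical radius being 1 has to be converted into the norm estimates
   |S z| <= 1 for the relevant z, that is, the relevant part of the fact that
   both spaces have numerical index 1. *)

From HB Require Import structures.
Require Import Defs.
From mathcomp Require Import all_boot all_order all_algebra.
From mathcomp Require Import all_classical all_reals all_analysis.
From mathcomp Require Import complex ring.

Set Implicit Arguments.
Unset Strict Implicit.
Unset Printing Implicit Defensive.

Import Order.TTheory GRing.Theory Num.Theory.
Import numFieldNormedType.Exports.

Local Open Scope classical_set_scope.
Local Open Scope ring_scope.

(** * Moduli and phases of real or complex scalars *)

Lemma RorC_archi (R : realType) (k : scalar_kind) (e : RorC R k) :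
  0 < e -> exists n : nat, n.+2%:R^-1 < e.
Proof.
move=> e0; suff [n en] : exists n : nat, e^-1 < n%:R.
  exists n; rewrite invf_plt ?posrE ?ltr0n// (lt_le_trans en)// ler_nat.
  by rewrite -addn2 leq_addr.
have : 0 < e^-1 by rewrite invr_gt0.
case: k e e0 => e _; move: e^-1 => {e} /= e e0.
  exists (Num.truncn e).+1; have /andP[] := truncn_itv (ltW e0); by [].
case: e e0 => a b; rewrite ltcE /= => /andP[/eqP b0 a0].
exists (Num.truncn a).+1; have /andP[_ an] := truncn_itv (ltW a0).
rewrite -(rmorph_nat (real_complex R)) ltcE/=; apply/andP; split=> //.
by rewrite b0.
Qed.

Lemma norm_sg (K : numFieldType) (x : K) : x != 0 -> `|x / `|x| | = 1.
Proof. by move=> x0; rewrite normf_div normr_id divff// normr_eq0. Qed.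

Lemma norm_sgV_le1 (K : numFieldType) (x : K) : `| `|x| / x | <= 1.
Proof.
have [->|x0] := eqVneq x 0; first by rewrite invr0 mulr0 normr0.
by rewrite normf_div normr_id divff// normr_eq0.
Qed.

Lemma norm_sgVM (K : numFieldType) (x : K) : `|x| / x * x = `|x|.
Proof.
have [->|x0] := eqVneq x 0; first by rewrite mulr0 normr0.
by rewrite divfK.
Qed.

(** Unlike [a / |a|], the phase [r] stays unimodular at [a = 0], as the norm-one functionals built
    from it require. *)
Lemma norm_phase (K : numFieldType) (a : K) : exists2 r, `|r| = 1 & a = r * `|a|.
Proof.
have [->|a0] := eqVneq a 0; first by exists 1; rewrite ?normr1// normr0 mulr0.
by exists (a / `|a|); rewrite ?norm_sg// divfK ?normr_eq0.
Qed.

Section linear_of.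
Context {K : numFieldType} {X Y : normedModType K}.

Definition linear_of (f : X -> Y) (lf : linear f) : {linear X -> Y} :=
  HB.pack f (GRing.isLinear.Build K X Y _ f lf).

End linear_of.

(** * Operators and states *)

Section supremum.
Context {R : realType} {k : scalar_kind}.
Local Notation K := (RorC R k).

Lemma supremum_max (A : set K) a : A a -> ubound A a -> supremum 0 A = a.
Proof.
move=> Aa Ua; rewrite /supremum ifF; last first.
  by apply/eqP => A0; rewrite A0 in Aa.
have Sa : supremums A a by split=> // b; apply.
case: xgetP => [b _ [Ub lb]|/(_ _ Sa)//].
by apply/eqP; rewrite eq_le lb//= Ub.
Qed.

(** Nonnegative elements of [K] lie on the real half line, where a nonempty bounded set has a
    supremum; the default value is thus not taken. *)
Lemma supremum_isLub (A : set K) : A !=set0 -> (forall x, A x -> 0 <= x) ->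
  has_ubound A -> isLub A (supremum 0 A).
Proof.
move=> A0 An Ab; have [s sA] := RorC_lub A0 An Ab.
rewrite /supremum ifF; last by apply/eqP => A0'; case: A0 => x; rewrite A0'.
by case: xgetP => [b _ //|/(_ s)].
Qed.

End supremum.

Section operators.
Context {R : realType} {k : scalar_kind}.
Local Notation K := (RorC R k).
Implicit Types X Y Z : normedModType K.

Lemma contraction_continuous X Y (f : {linear X -> Y}) :
  (forall x, `|f x| <= `|x|) -> continuous f.
Proof.
move=> f1; apply/linear_bounded_continuous/bounded_funP => r.
by exists r => x; apply: le_trans.
Qed.

Lemma opnorm_max X Y (f : X -> Y) x : (forall z, `|f z| <= `|z|) ->
  `|x| <= 1 -> `|f x| = 1 -> opnorm f = 1.
Proof.
move=> f1 x1 fx; apply: supremum_max; first by exists x.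
by move=> _ [z z1 <-]; rewrite (le_trans (f1 z)).
Qed.

Lemma opnorm_isLub X Y (f : {linear X -> Y}) : continuous f ->
  isLub [set `|f x| | x in [set x | `|x| <= 1]] (opnorm f).
Proof.
move=> /linear_bounded_continuous/bounded_funP/(_ 1)[M fM].
apply: supremum_isLub.
- by exists `|f 0|, 0; rewrite //= normr0.
- by move=> _ [x _ <-].
- by exists M => _ [x x1 <-]; apply: fM.
Qed.

Lemma opnormP X Y (f : {linear X -> Y}) x : continuous f ->
  `|f x| <= opnorm f * `|x|.
Proof.
move=> /opnorm_isLub[ub _]; have [->|x0] := eqVneq x 0.
  by rewrite linear0 !normr0 mulr0.
rewrite -ler_pdivrMr ?normr_gt0//; apply: ub.
exists (`|x|^-1 *: x).
  by rewrite /= normrZ normfV normr_id mulVf ?normr_eq0.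
by rewrite linearZ/= normrZ normfV normr_id mulrC.
Qed.

Lemma opnorm_sub_lt X Y (f g : {linear X -> Y}) e x : continuous f ->
  continuous g -> opnorm (f \- g) < e -> `|f x - g x| <= e * `|x|.
Proof.
move=> cf cg fge; apply: le_trans (ler_wpM2r (normr_ge0 x) (ltW fge)).
apply: (@opnormP X Y (f \- g)) => z.
by apply: continuousB; [exact: cf|exact: cg].
Qed.

Lemma dual_sphere_le X (f : {linear X -> K^o}) x :
  dual_unit_sphere f -> `|f x| <= `|x|.
Proof. by move=> [cf f1]; rewrite (le_trans (opnormP x cf))// f1 mul1r. Qed.

(** Both norms are forced: [1 = |f x| <= |x| <= 1], and [f] attains its norm at [x]. *)
Lemma statesI X (f : {linear X -> K^o}) x :
  (forall z, `|f z| <= `|z|) -> `|x| <= 1 -> f x = 1 -> states (x, f).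
Proof.
move=> f1 x1 fx; have fxn : `|f x| = 1 by rewrite fx normr1.
split=> //=.
- by apply/eqP; rewrite eq_le x1 -fxn f1.
- by split; [exact: contraction_continuous|exact: opnorm_max fxn].
Qed.

Lemma numerical_radius_max X (T : X -> X) p : (forall z, `|T z| <= `|z|) ->
  states p -> `|p.2 (T p.1)| = 1 -> numerical_radius T = 1.
Proof.
move=> T1 sp pT; apply: supremum_max; first by exists p.
move=> _ [[x f] [/= x1 f1 _] <-].
by rewrite (le_trans (dual_sphere_le _ f1))// (le_trans (T1 x))// x1.
Qed.

Lemma numerical_radius_ge X (S : {linear X -> X}) x (f : {linear X -> K^o}) :
  continuous S -> states (x, f) -> `|f (S x)| <= numerical_radius S.
Proof.
move=> cS s; pose A := [set `|p.2 (S p.1)| | p in @states K X].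
have [|||+ _] := @supremum_isLub R k A; last by apply; exists (x, f).
- by exists `|f (S x)|, (x, f).
- by move=> _ [p _ <-].
exists (opnorm S) => _ [[y g] [/= y1 g1 _] <-].
by rewrite (le_trans (dual_sphere_le _ g1))// (le_trans (opnormP _ cS))// y1 mulr1.
Qed.

(** For [x] nonzero, [x] divided by [f x] forms a state with [f]; homogeneity gives the bound. *)
Lemma numerical_radius_attained X (S : {linear X -> X}) x
    (f : {linear X -> K^o}) : continuous S -> dual_unit_sphere f ->
  `|f x| = `|x| -> `|f (S x)| <= numerical_radius S * `|x|.
Proof.
move=> cS f1 fx; have [->|x0] := eqVneq x 0.
  by rewrite !linear0 !normr0 mulr0.
have fx0 : f x != 0 by rewrite -normr_eq0 fx normr_eq0.
have s : states ((f x)^-1 *: x, f).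
  apply: statesI => [z||]; first exact: dual_sphere_le.
  - by rewrite normrZ normfV fx mulVf// normr_eq0.
  - by rewrite linearZ/= /GRing.scale/= mulVf.
have := numerical_radius_ge cS s; rewrite !linearZ/= normrM normfV fx.
by rewrite mulrC ler_pdivrMr// normr_gt0.
Qed.

(** The chain [1 <= c |a| + |b| <= c + (1 - c)] consists of equalities. Leaving [b] unscaled avoids
    a division by [1 - c], which may be 0. *)
Lemma norm_convex_eq1 (a b c : K) : 0 < c -> `|a| <= 1 -> `|b| <= 1 - c ->
  `|c * a + b| = 1 -> `|a| = 1 /\ `|b| = 1 - c.
Proof.
move=> c0 a1 bc cab.
have h : 1 <= c * `|a| + `|b|.
  by rewrite -cab (le_trans (ler_normD _ _))// normrM gtr0_norm.
have ca : c * `|a| <= c by rewrite ger_pMr.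
split; apply/eqP; rewrite eq_le ?a1 ?bc/=; last first.
  by rewrite lerBlDl (le_trans h)// lerD2r.
rewrite -(ler_pM2l c0) mulr1 -(lerD2r (1 - c)) addrC subrK.
by rewrite (le_trans h)// lerD2l.
Qed.

(** Convexity is used twice. Applied to [f x = 1], it shows that [f] attains its norm at [y] and
    [z]; the numerical radius then bounds [f (S y)] and [f (S z)], and convexity applies again to
    [|f (S x)| = 1]. *)
Lemma state_face X (S : {linear X -> X}) (f : {linear X -> K^o}) x y z (c : K) :
  continuous S -> numerical_radius S = 1 -> states (x, f) -> `|f (S x)| = 1 ->
  0 < c -> x = c *: y + z -> `|y| <= 1 -> `|z| <= 1 - c ->
  `|f y| = 1 /\ `|f (S y)| = 1.
Proof.
move=> cS S1 [/= x1 f1 fx] fSx c0 E y1 zc.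
have fy1 : `|f y| <= 1 by rewrite (le_trans (dual_sphere_le _ f1)).
have fz1 : `|f z| <= 1 - c by rewrite (le_trans (dual_sphere_le _ f1)).
have [|fy fz] := norm_convex_eq1 c0 fy1 fz1.
  by move/(congr1 Num.norm): fx; rewrite E linearP normr1.
have fzn : `|f z| = `|z|.
  by apply/eqP; rewrite eq_le dual_sphere_le//= fz.
have fyn : `|f y| = `|y|.
  by apply/eqP; rewrite eq_le dual_sphere_le//= fy.
have := numerical_radius_attained cS f1 fyn.
have := numerical_radius_attained cS f1 fzn.
rewrite S1 !mul1r => fSz fSy; split => //.
have [] := norm_convex_eq1 c0 (le_trans fSy y1) (le_trans fSz zc) => //.
by move: fSx; rewrite E !linearP.
Qed.

End operators.

(** The order of [K] may be partial. The sequence eventually equals its own modulus, hence so does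
    its limit. *)
Lemma cvg_ge0 (K : numFieldType) (x : nat -> K) (l : K) :
  x @ \oo --> l -> (\forall n \near \oo, 0 <= x n) -> 0 <= l.
Proof.
move=> xl x0; suff -> : l = `|l| by [].
apply: (@cvg_unique _ (@norm_hausdorff K K) (x @ \oo)) => //.
apply: cvg_trans (cvg_norm xl); apply: near_eq_cvg.
by apply: filterS x0 => n x0; rewrite ger0_norm.
Qed.

(** * The space C_0(L) *)

Section RorC_of_real.
Context {R : realType}.

Definition RorC_of_real (k : scalar_kind) : R -> RorC R k :=
  match k with
  | RealScalars => id
  | ComplexScalars => real_complex R
  end.

Lemma RorC_of_real0 k : RorC_of_real k 0 = 0.
Proof. by case: k. Qed.

Lemma RorC_of_real1 k : RorC_of_real k 1 = 1.
Proof. by case: k. Qed.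

Lemma RorC_of_real_itv k x : 0 <= x <= 1 -> 0 <= RorC_of_real k x <= 1.
Proof. by case: k => //; rewrite !lecE/= eqxx. Qed.

Lemma RorC_of_real_continuous k : continuous (RorC_of_real k).
Proof.
case: k => /= x; first exact: cvg_id.
apply/(@cvgrPdist_lt _ (RorC R ComplexScalars)) => -[e i].
rewrite ltcE/= => /andP[/eqP -> e0].
near=> y; rewrite -rmorphB normc_def/= expr0n addr0 sqrtr_sqr ltcR.
by near: y; apply: cvgr_dist_lt.
Unshelve. all: by end_near. Qed.

End RorC_of_real.

Section C0_theory.
Context {R : realType} {k : scalar_kind} {L : topologicalType}.
Local Notation K := (RorC R k).
Local Notation C0 := (C0 R k L).
Implicit Types f g : C0.

Lemma C0_continuous f : continuous f.
Proof. by case: f => f /= /asboolP[]. Qed.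

Lemma C0_compact_ge f (e : K) : 0 < e -> compact [set x | e <= `|f x|].
Proof. by case: f => f /= /asboolP[_]; apply. Qed.

(* An unbounded range of norms would give [f] the junk supremum 0, that is,
   [f = 0]. *)
Lemma C0_pointwise_le f x : `|f x| <= `|f|.
Proof.
have [|||+ _] := @supremum_isLub R k (range (fun x => `|f x|)).
- by exists `|f x|, x.
- by move=> _ [y _ <-].
- apply: contrapT => nb; apply: (nb); exists 0 => _ [y _ <-].
  suff -> : f = 0 by rewrite normr0.
  by apply/normr0_eq0/supremum_out => -[].
by apply; exists x.
Qed.

Lemma C0_norm_le f (M : K) : 0 <= M -> (forall x, `|f x| <= M) -> `|f| <= M.
Proof.
(* For empty [L] the norm is the default supremum 0, which is where [0 <= M] enters. *)
move=> M0 fM; have [[x0]|L0] := pselect (inhabited L); last first.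
  suff -> : `|f| = 0 by [].
  by apply: supremum_out => -[[_ [x _ _]] _]; case: (L0 (inhabits x)).
have [|||_ +] := @supremum_isLub R k (range (fun x => `|f x|)).
- by exists `|f x0|, x0.
- by move=> _ [x _ <-].
- by exists M => _ [x _ <-].
by apply => _ [x _ <-].
Qed.

Lemma closed_norm_ge (h : L -> K) (e : K) : 0 < e -> continuous h ->
  closed [set x | e <= `|h x|].
Proof.
move=> e0 ch; rewrite (_ : [set _ | _] = h @^-1` (~` ball (0 : K) e)).
  apply: preimage_closed => [x _|]; first exact: ch.
  exact/open_closedC/ball_open.
apply/seteqP; split=> x /=; rewrite -ball_normE /= sub0r normrN.
  by move=> eh /(le_lt_trans eh); rewrite ltxx.
by move/negP; rewrite real_ltNge ?negbK// gtr0_real.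
Qed.

(** Superlevel sets of [h] are closed subsets of compact ones. The family [A] covers both uses:
    superlevel sets of another element, and one fixed compact neighbourhood. *)
Lemma C0_of_dominated (h : L -> K) (A : K -> set L) : continuous h ->
  (forall e, 0 < e -> compact (A e)) ->
  (forall e x, 0 < e -> e <= `|h x| -> A e x) ->
  exists f, f =1 h.
Proof.
move=> ch cA hA; suff hP : h \in vanishing_continuous by exists (MkC0 hP).
apply/asboolP; split=> // e e0.
apply: (subclosed_compact (closed_norm_ge e0 ch) (cA _ e0)) => x /=.
exact: hA.
Qed.

Lemma C0_mul f (b : L -> K) : continuous b -> (forall x, `|b x| <= 1) ->
  exists g, g =1 f \* b.
Proof.
move=> cb b1; apply: (@C0_of_dominated _ (fun e => [set x | e <= `|f x|])).
- by move=> x; apply: continuousM; [exact: C0_continuous|exact: cb].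
- by move=> e; apply: C0_compact_ge.
- by move=> e x _ /le_trans; apply; rewrite normrM ler_piMr.
Qed.

Lemma C0_eval_linear x : linear (fun f : C0 => f x : K^o).
Proof. by []. Qed.

Definition C0_eval x : {linear C0 -> K^o} := linear_of (C0_eval_linear x).

Lemma C0_sumE n (c : nat -> K) (g : nat -> C0) x :
  (\sum_(i < n) c i *: g i) x = \sum_(i < n) c i * g i x.
Proof.
by rewrite -[LHS]/(C0_eval x _) linear_sum.
Qed.

End C0_theory.

(** * Bump functions on an infinite locally compact Hausdorff space *)

Section bumps.
Context {R : realType} {k : scalar_kind} {L : topologicalType}.
Hypothesis L_infinite : infinite_set [set: L].
Hypothesis L_locally_compact : locally_compact [set: L].
Hypothesis L_hausdorff : hausdorff_space L.
Local Notation K := (RorC R k).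
Local Notation C0 := (C0 R k L).

Lemma RorC_urysohn t (B : set L) : closed B -> ~ B t ->
  exists f : L -> K, [/\ continuous f, (forall x, 0 <= f x <= 1), f t = 1 &
    forall x, B x -> f x = 0].
Proof.
move=> cB Bt.
have sep : uniform_separator [set t] B.
  exact: (@locally_compact_completely_regular L R).
pose f : L -> R := Urysohn [set t] B.
have cf : continuous f by exact: Urysohn_continuous.
have f01 x : 0 <= f x <= 1.
  by have := @Urysohn_range L R [set t] B (f x); apply; exists x.
have ft : f t = 0.
  by apply: (@Urysohn_sub0 L R _ _ sep); exists t.
have fB x : B x -> f x = 1.
  by move=> Bx; apply: (@Urysohn_sub1 L R _ _ sep); exists x.
have ce : continuous (@RorC_of_real R k).
  exact: RorC_of_real_continuous.
(* The Urysohn function is 0 at [t] and 1 on [B], so it is reversed. *)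
exists (fun x => RorC_of_real k (1 - f x)); split=> [x|x||x Bx].
- apply: (@continuous_comp _ _ _ (fun x => 1 - f x)); last exact: ce.
  by apply: continuousB; [exact: cvg_cst|exact: cf].
- have /andP[f0 f1] := f01 x.
  by rewrite RorC_of_real_itv// subr_ge0 f1 gerBl.
- by rewrite ft subr0 RorC_of_real1.
- by rewrite fB// subrr RorC_of_real0.
Qed.

(** Separating [t] also from the complement of the interior of a compact neighbourhood makes the
    function vanish off a compact set, hence at infinity. *)
Lemma C0_bump t (A : set L) : closed A -> ~ A t ->
  exists f : C0, [/\ forall x, 0 <= f x <= 1, f t = 1 &
    forall x, A x -> f x = 0].
Proof.
move=> cA At.
have [U] := L_locally_compact I (x := t).
rewrite withinET => tU [cptU cU].
have [||f [cf f01 ft f0]] := @RorC_urysohn t (A `|` ~` U°).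
- by apply: closedU => //; apply: open_closedC; exact: open_interior.
- by case => //; apply.
have [|e|e x e0 xe|g gf] := @C0_of_dominated R k L f (fun=> U) => //.
- apply: contrapT => Ux; move: xe; rewrite f0 ?normr0.
    by move=> /(lt_le_trans e0); rewrite ltxx.
  by right => /interior_subset.
exists g; split=> [x||x Ax]; rewrite gf//.
by apply: f0; left.
Qed.

(** Induction: a bump [f] at a new point [s], zero at the old points, is added, and the old bumps
    are multiplied by [1 - f]. This kills them at [s], keeps their values at the old points, and
    bounds the new sum by [(1 - f) + f = 1]. *)
Lemma C0_bumps n : exists (t : nat -> L) (g : nat -> C0),
  [/\ forall i x, (i < n)%N -> 0 <= g i x,
      forall x, \sum_(i < n) g i x <= 1 &
      forall i j, (i < n)%N -> (j < n)%N -> g i (t j) = (i == j)%:R].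
Proof.
elim: n => [|n [t [g [g0 g1 gt]]]].
  have /infinite_setN0[t _] := L_infinite.
  by exists (fun=> t), (fun=> 0); split=> // x; rewrite big_ord0.
pose A := t @` `I_n; have finA : finite_set A.
  by apply: finite_image; exact: finite_II.
have [s As] : exists s, ~ A s.
  apply: contrapT => /forallNP AL; apply: L_infinite.
  by apply: sub_finite_set finA => x _; apply: contrapT; exact: AL.
have cA : closed A.
  move/hausdorff_accessible/accessible_finite_set_closed : L_hausdorff.
  by apply.
have [f [f01 fs f0]] := C0_bump cA As.
have cf1 : continuous (fun x => 1 - f x).
  by move=> x; apply: continuousB; [exact: cvg_cst|exact: C0_continuous].
have f1 x : `|1 - f x| <= 1.
  by have /andP[f0x f1x] := f01 x; rewrite ger0_norm ?subr_ge0// gerBl.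
have /choice[h hE] i := C0_mul (g i) cf1 f1.
exists (fun i => if i == n then s else t i), (fun i => if i == n then f else h i).
have f1_ge0 x : 0 <= 1 - f x by rewrite subr_ge0; have /andP[] := f01 x.
split=> [i x|x|i j].
- rewrite ltnS leq_eqVlt; case: eqP => [_ _|_ /= ni].
    by have /andP[] := f01 x.
  by rewrite hE mulr_ge0// g0.
- rewrite big_ord_recr/= eqxx.
  under eq_bigr do rewrite ltn_eqF// hE.
  rewrite -mulr_suml -[leRHS](subrK (f x)) lerD2r.
  by rewrite ler_piMl.
- rewrite !ltnS [(i <= n)%N]leq_eqVlt [(j <= n)%N]leq_eqVlt.
  case: eqP => [->|_]; case: eqP => [->|_] //=.
  + by rewrite eqxx fs.
  + by move=> _ jn; rewrite f0 ?gtn_eqF//; exists j.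
  + by move=> ni _; rewrite hE/= fs subrr mulr0 ltn_eqF.
  + by move=> ni nj; rewrite hE/= gt// f0 ?subr0 ?mulr1//; exists j.
Qed.

End bumps.

(** * The space l_1 *)

Section l1_theory.
Context {R : realType} {k : scalar_kind}.
Local Notation K := (RorC R k).
Local Notation l1 := (l1 R k).
Implicit Types u v : l1.

Lemma l1_cvg u : series (fun n => `|u n|) @ \oo --> `|u|.
Proof. by case: u => u us; have /asboolP := us. Qed.

Lemma l1_norm_le u (M : K) : (\forall n \near \oo, \sum_(i < n) `|u i| <= M) ->
  `|u| <= M.
Proof.
move=> uM; rewrite -subr_ge0; apply: cvg_ge0.
  by apply: cvgB; [exact: cvg_cst|exact: l1_cvg].
by apply: filterS uM => n; rewrite subr_ge0 /series/= big_mkord.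
Qed.

Lemma l1_partial_le u n : \sum_(i < n) `|u i| <= `|u|.
Proof.
rewrite -subr_ge0; apply: cvg_ge0.
  by apply: cvgB; [exact: l1_cvg|exact: cvg_cst].
exists n => // m /= nm; rewrite subr_ge0 /series/=.
rewrite -(big_mkord xpredT (fun i => `|u i|)) (@big_cat_nat _ _ _ n 0 m)//=.
by rewrite lerDl sumr_ge0.
Qed.

Lemma l1_coord_le u i : `|u i| <= `|u|.
Proof.
by rewrite (le_trans _ (l1_partial_le u i.+1))// big_ord_recr/= lerDr sumr_ge0.
Qed.

Lemma l1_delta_subproof i : (fun n => (n == i)%:R : K) \in @Defs.summable R k.
Proof.
apply/asboolP; apply: (@is_cvg_near_cst _ K^o 1).
exists i.+1 => // n /= ni.
rewrite /series/= big_mkord (bigD1 (Ordinal ni))//= eqxx normr1 big1 ?addr0//.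
move=> j ji; rewrite [_ == _]negbTE ?normr0//.
Qed.

Definition l1_delta i : l1 := MkL1 (l1_delta_subproof i).

Lemma l1_delta_norm i : `|l1_delta i| = 1.
Proof.
apply/eqP; rewrite eq_le; apply/andP; split.
  apply: l1_norm_le; exists i.+1 => // n /= ni.
  rewrite (bigD1 (Ordinal ni))//= eqxx normr1 big1 ?addr0//.
  by move=> j ji; rewrite [_ == _]negbTE ?normr0.
by have := l1_coord_le (l1_delta i) i; rewrite /= eqxx normr1.
Qed.

(** The coordinate [i] becomes 0 and the others are unchanged. This additivity lets a unit vector be
    split off convexly. *)
Lemma l1_sub_coord_norm u i : `|u - u i *: l1_delta i| <= `|u| - `|u i|.
Proof.
apply: l1_norm_le; exists i.+1 => // n ni; have {}ni : (i < n)%N := ni.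
rewrite lerBrDr (le_trans _ (l1_partial_le u n))//.
rewrite [leRHS](bigD1 (Ordinal ni))// [leRHS]addrC lerD2r.
have E j : (u - u i *: l1_delta i) j = u j - u i * (j == i)%:R by [].
rewrite [leLHS](bigD1 (Ordinal ni))// (E (Ordinal ni)) eqxx mulr1 subrr.
rewrite normr0 /= add0r; apply: ler_sum => j ji.
have Ej : (u - u i *: l1_delta i) j = u j.
  by rewrite E (_ : (_ == _) = false) ?mulr0 ?subr0//; apply/negbTE.
by rewrite -[in leRHS]Ej.
Qed.

Lemma l1_fin_linear n (Y : normedModType K) (a : nat -> Y) :
  linear (fun u : l1 => \sum_(i < n) u i *: a i).
Proof.
move=> c u v; rewrite scaler_sumr -big_split/=; apply: eq_bigr => i _.
by rewrite scalerDl scalerA.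
Qed.

(** The operator sending the i-th unit vector to [a i] for [i < n] and to 0 beyond; the finite sum
    avoids questions of convergence. *)
Definition l1_fin n (Y : normedModType K) (a : nat -> Y) : {linear l1 -> Y} :=
  linear_of (l1_fin_linear n a).

Lemma l1_fin_contraction n (Y : normedModType K) (a : nat -> Y) u :
  (forall i, `|a i| <= 1) -> `|l1_fin n a u| <= `|u|.
Proof.
move=> a1; rewrite (le_trans _ (l1_partial_le u n))//.
rewrite (le_trans (ler_norm_sum _ _ _))//; apply: ler_sum => i _.
by rewrite normrZ ler_piMr.
Qed.

Lemma l1_fin_delta n (Y : normedModType K) (a : nat -> Y) i : (i < n)%N ->
  l1_fin n a (l1_delta i) = a i.
Proof.
move=> ni; rewrite /l1_fin/= (bigD1 (Ordinal ni))//= eqxx scale1r big1 ?addr0//.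
move=> j ji; rewrite (_ : (_ == _) = false) ?scale0r//; exact/negbTE.
Qed.

End l1_theory.

(** * The test operator *)

(** The final numerical contradiction, which explains the tolerance 1/4 used throughout. *)
Lemma quarter_sqr_gt (K : numFieldType) :
  4%:R^-1 < (1 - 4%:R^-1) * (1 - 4%:R^-1) :> K.
Proof.
have -> : (1 - 4%:R^-1) * (1 - 4%:R^-1) = 9%:R / 16%:R :> K by field.
have -> : 4%:R^-1 = 4%:R / 16%:R :> K by field.
by rewrite ltr_pM2r ?invr_gt0 ?ltr0n// ltr_nat.
Qed.

Section test_operator.
Context {R : realType} {k : scalar_kind} {L : topologicalType}.
Local Notation K := (RorC R k).
Local Notation C0 := (C0 R k L).
Local Notation l1 := (l1 R k).
Variables (m : nat) (t : nat -> L) (g : nat -> C0).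
Local Notation n := m.+2.
Hypothesis g_ge0 : forall i x, (i < n)%N -> 0 <= g i x.
Hypothesis g_sum_le1 : forall x, \sum_(i < n) g i x <= 1.
Hypothesis g_t : forall i j, (i < n)%N -> (j < n)%N -> g i (t j) = (i == j)%:R.

Let n_neq0 : n%:R != 0 :> K.
Proof. by rewrite pnatr_eq0. Qed.

Let sum_inv : \sum_(i < n) n%:R^-1 = 1 :> K.
Proof. by rewrite sumr_const card_ord -[LHS]mulr_natr mulVf. Qed.

Lemma C0_mean_linear :
  linear (fun h : C0 => n%:R^-1 * \sum_(j < n) h (t j) : K^o).
Proof.
move=> c h h'; rewrite /GRing.scale/= mulrCA -mulrDr; congr (_ * _).
by rewrite mulr_sumr -big_split.
Qed.

Definition C0_mean : {linear C0 -> K^o} := linear_of C0_mean_linear.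

Lemma C0_mean_contraction h : `|C0_mean h| <= `|h|.
Proof.
rewrite [C0_mean h]/= normrM normfV normr_nat.
rewrite ler_pdivrMl ?ltr0n// (le_trans (ler_norm_sum _ _ _))//.
rewrite (le_trans (ler_sum _ (fun (j : 'I_n) _ => C0_pointwise_le h (t j))))//.
by rewrite sumr_const card_ord mulr_natl.
Qed.

(** The scalars 1 bring the sum into the form evaluated by [C0_sumE]. *)
Definition total_bump : C0 := \sum_(i < n) 1 *: g i.

Lemma total_bumpE x : total_bump x = \sum_(i < n) g i x.
Proof.
rewrite [LHS](C0_sumE _ (fun=> 1)).
by apply: eq_bigr => i _; rewrite mul1r.
Qed.

Lemma total_bump_t j : (j < n)%N -> total_bump (t j) = 1.
Proof.
move=> jn; rewrite total_bumpE (bigD1 (Ordinal jn))//= g_t// eqxx big1 ?addr0//.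
by move=> i ij; rewrite g_t// (_ : (_ == _) = false)//; apply/negbTE.
Qed.

Lemma total_bump_le1 : `|total_bump| <= 1.
Proof.
apply: C0_norm_le => // x; rewrite total_bumpE ger0_norm//.
by apply: sumr_ge0 => i _; rewrite g_ge0.
Qed.

Lemma C0_mean_total_bump : C0_mean total_bump = 1.
Proof.
rewrite [LHS]/= (eq_bigr (fun=> 1)) => [|j _]; last by rewrite total_bump_t.
by rewrite sumr_const card_ord mulVf.
Qed.

Definition punctured (i : nat) : C0 := \sum_(j < n) (j != i :> nat)%:R *: g j.

Lemma puncturedE i x : punctured i x = \sum_(j < n) (j != i :> nat)%:R * g j x.
Proof. exact: (C0_sumE _ (fun j => (j != i)%:R)). Qed.

Lemma punctured_le1 i : `|punctured i| <= 1.
Proof.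
apply: C0_norm_le => // x; rewrite puncturedE.
rewrite ger0_norm; last first.
  by apply: sumr_ge0 => j _; rewrite mulr_ge0 ?g_ge0.
rewrite (le_trans _ (g_sum_le1 x))//; apply: ler_sum => j _.
by rewrite ler_piMl ?g_ge0//; case: (_ != _).
Qed.

Lemma punctured_t i j : (j < n)%N -> punctured i (t j) = (j != i)%:R.
Proof.
move=> jn; rewrite puncturedE.
rewrite (bigD1 (Ordinal jn))//= g_t// eqxx mulr1 big1 ?addr0//.
by move=> l lj; rewrite g_t// (_ : (_ == j) = false) ?mulr0//; apply/negbTE.
Qed.

Definition test_op : {linear l1 -> C0} := l1_fin n punctured.

Lemma test_op_contraction u : `|test_op u| <= `|u|.
Proof. by apply: l1_fin_contraction => i; exact: punctured_le1. Qed.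

Lemma l1_coord_linear j : linear (fun u : l1 => u j : K^o).
Proof. by []. Qed.

Definition uniform_l1 : l1 := \sum_(i < n) n%:R^-1 *: l1_delta i.

Lemma uniform_l1E j : (j < n)%N -> uniform_l1 j = n%:R^-1.
Proof.
move=> jn; have -> : uniform_l1 j = \sum_(i < n) n%:R^-1 * (j == i)%:R.
  by rewrite -[LHS]/(linear_of (l1_coord_linear j) _) linear_sum.
rewrite (bigD1 (Ordinal jn))//= eqxx mulr1 big1 ?addr0// => i ij.
by rewrite [j == _]eq_sym (_ : (_ == _) = false) ?mulr0//; apply/negbTE.
Qed.

Lemma uniform_l1_le1 : `|uniform_l1| <= 1.
Proof.
rewrite (le_trans (ler_norm_sum _ _ _))// -[leRHS]sum_inv; apply: ler_sum => i _.
by rewrite normrZ l1_delta_norm mulr1 normfV normr_nat.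
Qed.

(** The sum functional norms the uniform point; it also serves as the l_1 part of the initial state
    on the 1-sum. *)
Lemma sum_uniform_l1 : l1_fin n (fun=> 1 : K^o) uniform_l1 = 1.
Proof.
rewrite linear_sum -[RHS]sum_inv; apply: eq_bigr => i _.
by rewrite linearZ l1_fin_delta//; exact: mulr1.
Qed.

(** At each [t j] exactly one of the [n] equally weighted terms vanishes and the others are 1. *)
Lemma C0_mean_test_op : C0_mean (test_op uniform_l1) = 1 - n%:R^-1.
Proof.
have E : test_op uniform_l1 = \sum_(i < n) n%:R^-1 *: punctured i.
  by rewrite linear_sum; apply: eq_bigr => i _; rewrite linearZ l1_fin_delta.
have Et j : (j < n)%N -> test_op uniform_l1 (t j) = 1 - n%:R^-1.
  move=> jn; rewrite E [LHS](C0_sumE _ (fun=> n%:R^-1)).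
  have Ei (i : 'I_n) : n%:R^-1 * punctured i (t j) =
      n%:R^-1 - n%:R^-1 * (i == j :> nat)%:R.
    rewrite punctured_t// eq_sym; case: eqP => _ /=.
      by rewrite mulr0 mulr1 subrr.
    by rewrite mulr0 subr0 mulr1.
  under eq_bigr do rewrite Ei.
  rewrite sumrB sum_inv (bigD1 (Ordinal jn))//= eqxx mulr1 big1 ?addr0// => i ij.
  by rewrite (_ : (_ == _) = false) ?mulr0//; apply/negbTE.
rewrite [LHS]/= (eq_bigr (fun=> 1 - n%:R^-1)) => [|j _]; last exact: Et.
by rewrite sumr_const card_ord -[X in _ * X]mulr_natl mulKf.
Qed.

Lemma uniform_l1_norm : `|uniform_l1| = 1.
Proof.
apply/eqP; rewrite eq_le uniform_l1_le1 -[leLHS]normr1 -[X in `|X|]sum_uniform_l1.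
by apply: l1_fin_contraction => _; rewrite normr1.
Qed.

Lemma punctured0_norm : `|punctured 0| = 1.
Proof.
apply/eqP; rewrite eq_le punctured_le1/=.
(* The point [t 1] is available because [n >= 2]. *)
by have := C0_pointwise_le (punctured 0) (t 1); rewrite punctured_t// normr1.
Qed.

Lemma test_op_delta_t (a : K) i : (i < n)%N -> test_op (a *: l1_delta i) (t i) = 0.
Proof.
move=> ni; have -> : test_op (a *: l1_delta i) = a *: punctured i.
  by rewrite linearZ l1_fin_delta.
by rewrite [LHS]/(a * punctured i (t i)) punctured_t// eqxx; exact: mulr0.
Qed.

Lemma uniform_l1_dist (u : l1) :
  \sum_(i < n) `|n%:R^-1 - u i| <= `|u - uniform_l1|.
Proof.
rewrite distrC (le_trans _ (l1_partial_le _ n))//; apply: ler_sum => i _.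
by rewrite -(uniform_l1E (ltn_ord i)).
Qed.

(* [u] is the l1-component of the perturbed point and [y] the perturbed
   functional on C_0(L); [c] and [b] stand for the value of the functional at
   [S z] and for the modulus of [S z], where [z] is the i-th unit vector up to
   a unimodular factor. *)
Lemma no_near_attainment (u : nat -> K) (y : {linear C0 -> K^o}) :
  \sum_(i < n) `|n%:R^-1 - u i| <= 4%:R^-1 ->
  (forall h, `|h| <= 1 -> `|y h - C0_mean h| <= 4%:R^-1) ->
  (forall i, (i < n)%N -> u i != 0 -> exists c (b : L -> K),
    [/\ `|c| = 1, continuous b, forall x, 0 <= b x <= 1, b (t i) <= 4%:R^-1 &
      forall h : C0, (forall x, `|h x| <= 1 - b x) -> `|c + y h| <= 1]) ->
  False.
Proof.
move=> ue ye H; set e : K := 4%:R^-1 in ue ye H.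
have e0 : 0 <= 1 - e.
  by rewrite subr_ge0 invf_le1 ?ler1n ?ltr0n.
(* For [u i = 0] the left side of the last clause is 0, so [h = 0] is admissible; otherwise [h] will
   be [g i] times [1 - b]. *)
pose good i (h : C0) := (i < n)%N -> [/\ y h = 0, forall x, `|h x| <= g i x,
    forall j, (j < n)%N -> j != i -> h (t j) = 0 &
    (1 - e) * (n%:R^-1 - `|n%:R^-1 - u i|) <= n%:R^-1 * h (t i)].
have /choice[h hP] i : exists h, good i h.
  have [ni|ni] := ltnP i n; last by exists 0; rewrite /good ltnNge ni.
  have [ui0|ui0] := eqVneq (u i) 0.
    exists 0 => _; split=> [|x|//|]; rewrite ?linear0//=.
      by rewrite normr0 g_ge0.
    by rewrite ui0 subr0 normfV normr_nat subrr mulr0 mulr0.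
  have [c [b [c1 cb b01 bti cy]]] := H i ni ui0.
  have b1 x : 0 <= 1 - b x <= 1.
    by have /andP[b0 b1] := b01 x; rewrite subr_ge0 b1 gerBl.
  have [||h hE] := @C0_mul R k L (g i) (fun x => 1 - b x).
  - by move=> x; apply: continuousB; [exact: cvg_cst|exact: cb].
  - by move=> x; have /andP[h0 h1] := b1 x; rewrite ger0_norm.
  have gi1 x : g i x <= 1.
    rewrite (le_trans _ (g_sum_le1 x))// (bigD1 (Ordinal ni))//= lerDl.
    by apply: sumr_ge0 => j _; exact: g_ge0.
  exists h => _; split=> [|x|j jn ji|].
  - apply/eqP; rewrite -normr_eq0 eq_le normr_ge0 andbT.
    (* The factor [s] aligns [y (s *: h)] with [c], so that [|c + y (s *: h)| = 1 + |y h|], which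
       must be at most 1. *)
    pose s := c * (`|y h| / y h).
    have /cy : forall x, `|(s *: h) x| <= 1 - b x.
      move=> x; have /andP[b0 b1'] := b1 x.
      rewrite [(s *: h) x]/(s * h x) normrM normrM c1 mul1r.
      rewrite (le_trans (ler_piMl _ (norm_sgV_le1 _)))//.
      by rewrite hE/= normrM ger0_norm ?g_ge0// ger0_norm// ler_piMl.
    rewrite linearZ/= /s -[_ *: _]/(_ * _) -mulrA norm_sgVM -{1}[c]mulr1.
    by rewrite -mulrDr normrM c1 mul1r ger0_norm ?addr_ge0// gerDl.
  - have /andP[b0 b1'] := b1 x.
    by rewrite hE/= normrM ger0_norm ?g_ge0// ger0_norm// ler_piMr ?g_ge0.
  - by rewrite hE/= g_t// eq_sym (negbTE ji) mul0r.
  - rewrite hE/= g_t// eqxx mul1r (@le_trans _ _ ((1 - e) * n%:R^-1))//.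
      by rewrite ler_wpM2l// gerBl.
    by rewrite mulrC ler_wpM2l ?lerD2l ?lerN2// invr_ge0.
pose hs : C0 := \sum_(i < n) 1 *: h i.
have hsE x : hs x = \sum_(i < n) h i x.
  rewrite [LHS](C0_sumE _ (fun=> 1)).
  by apply: eq_bigr => i _; rewrite mul1r.
have hs1 : `|hs| <= 1.
  apply: C0_norm_le => // x; rewrite hsE (le_trans (ler_norm_sum _ _ _))//.
  rewrite (le_trans _ (g_sum_le1 x))//; apply: ler_sum => i _.
  by have [] := hP i (ltn_ord i).
have yhs : y hs = 0.
  rewrite linear_sum big1// => i _; rewrite scale1r.
  by have [] := hP i (ltn_ord i).
have hst (j : 'I_n) : hs (t j) = h j (t j).
  rewrite hsE (bigD1 j)//= big1 ?addr0// => i ij.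
  have [_ _ hz _] := hP i (ltn_ord i).
  by apply: hz => //; rewrite eq_sym.
(* Summed over [i], the weights [1/n] give 1 and the deviations of [u] cost at most [e]. *)
have mean_ge : (1 - e) * (1 - e) <= C0_mean hs.
  rewrite [leRHS]/= mulr_sumr.
  apply: (@le_trans _ _ (\sum_(i < n) (1 - e) * (n%:R^-1 - `|n%:R^-1 - u i|))).
    by rewrite -mulr_sumr ler_wpM2l// sumrB sum_inv lerD2l lerN2.
  apply: ler_sum => i _; rewrite hst.
  by have [] := hP i (ltn_ord i).
have := ye hs hs1; rewrite yhs sub0r normrN ger0_norm; last first.
  by rewrite (le_trans _ mean_ge)// mulr_ge0.
by move/(le_trans mean_ge)/(lt_le_trans (quarter_sqr_gt K)); rewrite ltxx.
Qed.

End test_operator.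

(** * The three spaces *)

Section main.
Context {R : realType} {k : scalar_kind} {L : topologicalType}.
Hypothesis L_infinite : infinite_set [set: L].
Hypothesis L_locally_compact : locally_compact [set: L].
Hypothesis L_hausdorff : hausdorff_space L.
Local Notation K := (RorC R k).
Local Notation C0 := (C0 R k L).
Local Notation l1 := (l1 R k).

(** The coefficient is a modulus and the phase goes into the vector, as the convexity arguments
    require. *)
Lemma l1_split (u : l1) i :
  u = `|u i| *: ((u i / `|u i|) *: l1_delta i) + (u - u i *: l1_delta i).
Proof.
rewrite scalerA mulrC.
have [->|ui0] := eqVneq (u i) 0; first by rewrite mul0r mul0r scale0r subr0 add0r.
by rewrite divfK ?normr_eq0// addrC subrK.
Qed.

Lemma test_data (eta : K) : 0 < eta -> exists m (t : nat -> L) (g : nat -> C0),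
  [/\ forall i x, (i < m.+2)%N -> 0 <= g i x,
      forall x, \sum_(i < m.+2) g i x <= 1,
      forall i j, (i < m.+2)%N -> (j < m.+2)%N -> g i (t j) = (i == j)%:R &
      1 - eta < `|(1 - m.+2%:R^-1 : K)|].
Proof.
move=> /RorC_archi[m em].
have [t [g [g0 g1 gt]]] :=
  @C0_bumps R k L L_infinite L_locally_compact L_hausdorff m.+2.
exists m, t, g; split=> //; rewrite ger0_norm ?ltrD2l ?ltrN2//.
by rewrite subr_ge0 invf_le1 ?ler1n ?ltr0n.
Qed.

(** * The pair of l_1 and C_0(L) *)

Lemma not_BPBZp : ~ BPBZp l1 C0.
Proof.
move=> /(_ 4%:R^-1); rewrite invr_gt0 ltr0n => /(_ isT)[eta].
move=> /test_data[m [t [g [g0 g1 gt eta1]]]].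
move=> /(_ (test_op m g) (C0_mean m t) (uniform_l1 m)) [].
- exact/contraction_continuous/test_op_contraction.
- apply: (@opnorm_max _ _ _ _ _ (l1_delta 0)); rewrite ?l1_delta_norm//.
    exact: test_op_contraction.
  by rewrite l1_fin_delta// (punctured0_norm g0 g1 gt).
- split; first exact/contraction_continuous/C0_mean_contraction.
  apply: (@opnorm_max _ _ _ _ _ (total_bump m g)).
  + exact: C0_mean_contraction.
  + exact: total_bump_le1.
  + by rewrite (C0_mean_total_bump gt) normr1.
- exact: uniform_l1_norm.
- by rewrite (C0_mean_test_op gt).
move=> y1 [x1 [S [[y1s x1s cS] [S1 y1S x1e y1e Se]]]].
apply: (@no_near_attainment _ _ _ m t g g0 g1 gt x1 y1) => [|h h1|i ni ui0].
- exact/(le_trans (uniform_l1_dist _ x1))/ltW.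
- have cm := contraction_continuous (@C0_mean_contraction R k L m t).
  by rewrite (le_trans (opnorm_sub_lt h y1s.1 cm y1e))// ler_piMr.
set z := (x1 i / `|x1 i|) *: l1_delta i.
have z1 : `|z| = 1 by rewrite normrZ l1_delta_norm mulr1 norm_sg.
have Sle w : `|S w| <= `|w| by have := opnormP w cS; rewrite S1 mul1r.
have Sz1 : `|S z| <= 1 by rewrite -z1.
(* With [b = |S z|] pointwise, [|h| <= 1 - b] keeps [S z + h] in the unit ball. *)
exists (y1 (S z)), (fun x => `|S z x|); split.
- have [||||//] := @norm_convex_eq1 R k (y1 (S z))
      (y1 (S (x1 - x1 i *: l1_delta i))) `|x1 i|.
  + by rewrite normr_gt0.
  + by rewrite (le_trans (dual_sphere_le _ y1s)).
  + rewrite (le_trans (dual_sphere_le _ y1s))// (le_trans (Sle _))//.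
    by rewrite (le_trans (l1_sub_coord_norm _ _))// x1s.
  + by move: y1S; rewrite {1}(l1_split x1 i) !linearP.
- by move=> x; apply: cvg_norm; exact: C0_continuous.
- by move=> x; rewrite normr_ge0 (le_trans (C0_pointwise_le _ _)).
(* Since [test_op m g z] vanishes at [t i], the value of [S z] there is bounded by the distance of
   the operators. *)
- have cT := contraction_continuous (test_op_contraction g0 g1).
  have := le_trans (C0_pointwise_le _ (t i)) (opnorm_sub_lt z cS cT Se).
  rewrite z1 mulr1 -[(S z - _) _]/(S z (t i) - test_op m g z (t i)).
  by rewrite (test_op_delta_t gt)// subr0.
- move=> h hb; rewrite -linearD (le_trans (dual_sphere_le _ y1s))//.
  apply: C0_norm_le => // x; rewrite (le_trans (ler_normD _ _))//.
  by rewrite addrC -lerBrDr hb.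
Qed.

(** The constraint fixes [s i = w^-1]. Rotating all other conjugate signs by the phase [r] of
    [w^-1 * a i] makes every term equal to [r |a j|]. *)
Lemma l1_norming (a : l1) (w : K) i N : `|w| = 1 -> (i < N)%N ->
  exists s : nat -> K^o, [/\ forall j, `|s j| <= 1, w * s i = 1 &
  exists2 r : K, `|r| = 1 & l1_fin N s a = r * \sum_(j < N) `|a j|].
Proof.
move=> w1 iN; have [r r1 ar] := norm_phase (w^-1 * a i).
have w0 : w != 0 by rewrite -normr_eq0 w1 oner_eq0.
exists (fun j => if j == i then w^-1 else r * (`|a j| / a j)); split.
- move=> j; case: eqP => _; first by rewrite normfV w1 invr1.
  by rewrite normrM r1 mul1r norm_sgV_le1.
- by rewrite eqxx divff.
exists r => //; rewrite mulr_sumr; apply: eq_bigr => j _.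
rewrite -[LHS]/(a j * _); case: eqP => [->|_].
  by rewrite mulrC ar normrM normfV w1 invr1 mul1r.
by rewrite mulrCA [a j * _]mulrC norm_sgVM.
Qed.

(** * The direct sum with the sum of the norms *)

Local Notation X1 := (sum1 l1 C0).

Lemma sum1_norm_pair (u : l1) (h : C0) : `|(u, h) : X1| = `|u| + `|h|.
Proof. by []. Qed.

Lemma sum1_functional_linear (f : {linear l1 -> K^o}) (f' : {linear C0 -> K^o}) :
  linear (fun p : X1 => f p.1 + f' p.2 : K^o).
Proof. by move=> c p q; rewrite !linearP scalerDr addrACA. Qed.

Definition sum1_functional f f' : {linear X1 -> K^o} :=
  linear_of (sum1_functional_linear f f').

Lemma sum1_functional_contraction (f : {linear l1 -> K^o})
    (f' : {linear C0 -> K^o}) : (forall u, `|f u| <= `|u|) ->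
  (forall h, `|f' h| <= `|h|) -> forall p, `|sum1_functional f f' p| <= `|p|.
Proof.
by move=> f1 f'1 p; rewrite (le_trans (ler_normD _ _))// lerD.
Qed.

Lemma sum1_op_linear (T : {linear l1 -> C0}) :
  linear (fun p : X1 => (0, T p.1) : X1).
Proof. by move=> c p q; congr pair => /=; rewrite ?scaler0 ?addr0 ?linearP. Qed.

Definition sum1_op (T : {linear l1 -> C0}) : {linear X1 -> X1} :=
  linear_of (sum1_op_linear T).

Lemma sum1_op_contraction (T : {linear l1 -> C0}) : (forall u, `|T u| <= `|u|) ->
  forall p, `|sum1_op T p| <= `|p|.
Proof.
by move=> T1 p; rewrite sum1_norm_pair normr0 add0r (le_trans (T1 _))// lerDl.
Qed.

Lemma sum1_inr_linear (f : {linear X1 -> K^o}) :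
  linear (fun h : C0 => f (0, h) : K^o).
Proof.
move=> c h h'; rewrite -linearP; congr (f _).
by congr pair => /=; rewrite scaler0 addr0.
Qed.

(** A norming sequence for [a] and the evaluation at [x], rotated to the same phase [r], form a
    functional that is 1 at the given unit vector and has modulus [|a 0| + ... + |a (N-1)| + |b x|]
    at its image. Then [N] tends to infinity. *)
Lemma sum1_numerical_index (S : {linear X1 -> X1}) i (w : K) x :
  continuous S -> numerical_radius S = 1 -> `|w| = 1 ->
  `|(S (w *: l1_delta i, 0)).1| + `|(S (w *: l1_delta i, 0)).2 x| <= 1.
Proof.
move=> cS S1 w1; case E : (S _) => [a b] /=.
rewrite -lerBrDr; apply: l1_norm_le; exists i.+1 => // N /= iN.
have [s [s1 ws [r r1 sa]]] := l1_norming a w1 iN.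
have [q q1 bq] := norm_phase (b x).
have ev_lin : linear (fun h : C0 => r / q * h x : K^o).
  by move=> c h h'; rewrite /GRing.scale/= mulrDr mulrCA.
pose f := sum1_functional (l1_fin N s) (linear_of ev_lin).
have f1 p : `|f p| <= `|p|.
  apply: sum1_functional_contraction => [u|h]; first exact: l1_fin_contraction.
  rewrite [X in `|X|]/= normrM normf_div r1 q1 divr1 mul1r.
  exact: C0_pointwise_le.
have fz : f (w *: l1_delta i, 0) = 1.
  rewrite [LHS]/= mulr0 addr0 -[LHS]/(l1_fin N s (w *: l1_delta i)).
  by rewrite linearZ l1_fin_delta.
have st : states ((w *: l1_delta i, 0) : X1, f).
  apply: statesI => //.
  by rewrite sum1_norm_pair normr0 addr0 normrZ l1_delta_norm w1 mulr1.
have := numerical_radius_ge cS st; rewrite S1 E.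
have q0 : q != 0 by rewrite -normr_eq0 q1 oner_eq0.
have -> : f (a, b) = r * (\sum_(j < N) `|a j| + `|b x|).
  rewrite mulrDr -sa; congr (_ + _); rewrite [LHS]/= {1}bq mulrA divfK//.
by rewrite normrM r1 mul1r ger0_norm ?addr_ge0 ?sumr_ge0// lerBrDr.
Qed.

Lemma not_BPBp_nu_sum1 : ~ BPBp_nu X1.
Proof.
have e1 : 4%:R^-1 < 1 :> K by rewrite invf_lt1 ?ltr1n ?ltr0n.
move=> /(_ 4%:R^-1); rewrite invr_gt0 ltr0n => /(_ isT e1)[eta].
move=> /test_data[m [t [g [g0 g1 gt eta1]]]].
pose T := sum1_op (test_op m g).
have T1 p : `|T p| <= `|p| by exact/sum1_op_contraction/test_op_contraction.
pose f1 : {linear l1 -> K^o} := l1_fin m.+2 (fun=> 1 : K^o).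
have f1le u : `|f1 u| <= `|u|.
  by apply: l1_fin_contraction => i; rewrite normr1.
pose x0' := sum1_functional f1 (C0_mean m t).
have x0'1 p : `|x0' p| <= `|p|.
  by apply: sum1_functional_contraction => //; exact: C0_mean_contraction.
move=> /(_ T (uniform_l1 m, 0) x0') [].
- exact: contraction_continuous.
- apply: statesI => //.
    by rewrite sum1_norm_pair normr0 addr0 uniform_l1_norm.
  rewrite -[LHS]/(f1 (uniform_l1 m) + C0_mean m t 0) linear0 addr0.
  exact: sum_uniform_l1.
(* The numerical radius is attained at the unit vector of index 0, whose image is 1 at [t 1]. *)
- pose f := sum1_functional f1 (C0_eval (t 1)).
  have f_le p : `|f p| <= `|p|.
    by apply: sum1_functional_contraction => // h; exact: C0_pointwise_le.
  apply: (@numerical_radius_max R k X1 T ((l1_delta 0, 0) : X1, f)) => //.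
    apply: statesI => //.
      by rewrite sum1_norm_pair normr0 addr0 l1_delta_norm.
    rewrite -[LHS]/(f1 (l1_delta 0) + C0_eval (t 1) 0) linear0 addr0.
    exact: l1_fin_delta.
  rewrite -[X in `|X|]/(f1 0 + test_op m g (l1_delta 0) (t 1)) linear0 add0r.
  by rewrite l1_fin_delta// (punctured_t gt)// normr1.
- rewrite -[X in _ < `|X|]/(f1 0 + C0_mean m t (test_op m g (uniform_l1 m))).
  by rewrite linear0 add0r (C0_mean_test_op gt).
move=> S [[u v] [x1' [[cS st S1 x1'S] [Se x1e x1'e]]]].
have [/= x1s x1's _] := st.
pose y := linear_of (sum1_inr_linear x1').
apply: (@no_near_attainment _ _ _ m t g g0 g1 gt u y) => [|h h1|i ni ui0].
- rewrite (le_trans (uniform_l1_dist _ u))// ltW// (le_lt_trans _ x1e)//.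
  by rewrite [leRHS]sum1_norm_pair lerDl.
- have := opnorm_sub_lt ((0, h) : X1) x1's.1 (contraction_continuous x0'1) x1'e.
  rewrite sum1_norm_pair normr0 add0r.
  rewrite -[x0' _]/(f1 0 + C0_mean m t h) linear0 add0r => /le_trans; apply.
  by rewrite ler_piMr.
set w := u i / `|u i|; set z : X1 := (w *: l1_delta i, 0).
have w1 : `|w| = 1 by rewrite norm_sg.
have z1 : `|z| = 1.
  by rewrite sum1_norm_pair normr0 addr0 normrZ l1_delta_norm mulr1.
(* All of [v] goes into the remainder, whose norm is at most [|u| - |u i| + |v| = 1 - |u i|]. *)
have [||||x1'z x1'Sz] := @state_face _ _ _ S x1' ((u, v) : X1) z
    ((u - u i *: l1_delta i, v) : X1) `|u i| cS S1 st x1'S _ _ _ _.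
- by rewrite normr_gt0.
- rewrite -[RHS]/((`|u i| *: (w *: l1_delta i) + (u - u i *: l1_delta i),
      `|u i| *: 0 + v) : X1).
  by rewrite -l1_split scaler0 add0r.
- by rewrite z1.
- rewrite sum1_norm_pair -x1s sum1_norm_pair addrAC lerD2r.
  exact: l1_sub_coord_norm.
have := sum1_numerical_index i _ cS S1 w1; rewrite -/z.
case Sz : (S z) => [a b] /= ab1.
(* The norm of [S z + (0, h)] is [|a| + |b + h|], so [|a|] has to be part of the bound. *)
exists (x1' (S z)), (fun x => `|a| + `|b x|); split=> //.
- move=> x; apply: cvgD; first exact: cvg_cst.
  by apply: cvg_norm; exact: C0_continuous.
- by move=> x; rewrite addr_ge0/=.
- have := opnorm_sub_lt z cS (contraction_continuous T1) Se.
  rewrite z1 mulr1 Sz; apply: le_trans.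
  rewrite -[T z]/((0, test_op m g (w *: l1_delta i)) : X1).
  rewrite -[leRHS]/(`|a - 0| + `|b - test_op m g (w *: l1_delta i)|) subr0 lerD2l.
  rewrite (le_trans _ (C0_pointwise_le _ (t i)))//.
  rewrite -[leRHS]/(`|b (t i) - test_op m g (w *: l1_delta i) (t i)|).
  by rewrite (test_op_delta_t gt)// subr0.
- move=> h hb; rewrite -[leLHS]/(`|x1' (S z) + x1' ((0, h) : X1)|) -linearD Sz.
  rewrite (le_trans (dual_sphere_le _ x1's))//.
  rewrite -[X in `|X|]/((a + 0, b + h) : X1) addr0 sum1_norm_pair -lerBrDl.
  apply: C0_norm_le => [|x].
    by rewrite subr_ge0 (le_trans _ (ab1 (t 0)))// lerDl.
  rewrite (le_trans (ler_normD _ _))// addrC -lerBrDr.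
  by rewrite -addrA -opprD hb.
Qed.

(** * The direct sum with the maximum norm *)

Local Notation Xoo := (l1 * C0)%type.

(** Norms are real, hence comparable even when the order of [K] is partial. *)
Lemma prod_norm_le (p : Xoo) (M : K) :
  (`|p| <= M) = (`|p.1| <= M) && (`|p.2| <= M).
Proof.
by rewrite prod_normE comparable_ge_max// real_comparable// normr_real.
Qed.

Lemma prod_norm_fst (p : Xoo) : `|p.1| <= `|p|.
Proof. by have := lexx `|p|; rewrite {1}prod_norm_le => /andP[]. Qed.

Lemma prod_norm_snd (p : Xoo) : `|p.2| <= `|p|.
Proof. by have := lexx `|p|; rewrite {1}prod_norm_le => /andP[]. Qed.

Lemma prod_inl_functional_linear (f : {linear l1 -> K^o}) :
  linear (fun p : Xoo => f p.1 : K^o).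
Proof. by move=> c p q; rewrite linearP. Qed.

Lemma prod_inr_functional_linear (f : {linear C0 -> K^o}) :
  linear (fun p : Xoo => f p.2 : K^o).
Proof. by move=> c p q; rewrite linearP. Qed.

Definition prod_inr_functional f : {linear Xoo -> K^o} :=
  linear_of (prod_inr_functional_linear f).

Lemma prod_op_linear (T : {linear l1 -> C0}) :
  linear (fun p : Xoo => (0, T p.1) : Xoo).
Proof. by move=> c p q; congr pair => /=; rewrite ?scaler0 ?addr0 ?linearP. Qed.

Definition prod_op (T : {linear l1 -> C0}) : {linear Xoo -> Xoo} :=
  linear_of (prod_op_linear T).

Lemma prod_op_contraction (T : {linear l1 -> C0}) :
  (forall u, `|T u| <= `|u|) -> forall p, `|prod_op T p| <= `|p|.
Proof.
move=> T1 p; rewrite prod_norm_le normr0 normr_ge0/=.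
by rewrite (le_trans (T1 _))// prod_norm_fst.
Qed.

Lemma prod_inr_linear (f : {linear Xoo -> K^o}) :
  linear (fun h : C0 => f (0, h) : K^o).
Proof.
move=> c h h'; rewrite -linearP; congr (f _).
by congr pair => /=; rewrite scaler0 addr0.
Qed.

(** A functional of the first component alone forms a state with any [v] of the unit ball;
    [l1_norming] supplies one that norms initial segments of [a] up to a phase. *)
Lemma prod_numerical_index_fst (S : {linear Xoo -> Xoo}) i (w : K) (v : C0) :
  continuous S -> numerical_radius S = 1 -> `|w| = 1 -> `|v| <= 1 ->
  `|(S (w *: l1_delta i, v)).1| <= 1.
Proof.
move=> cS S1 w1 v1; case E : (S _) => [a b] /=.
apply: l1_norm_le; exists i.+1 => // N /= iN.
have [s [s1 ws [r r1 sa]]] := l1_norming a w1 iN.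
pose f := linear_of (prod_inl_functional_linear (l1_fin N s)).
have f1 p : `|f p| <= `|p|.
  exact: le_trans (l1_fin_contraction N _ s1) (prod_norm_fst p).
have st : states ((w *: l1_delta i, v) : Xoo, f).
  apply: statesI => //.
    by rewrite prod_norm_le/= v1 normrZ l1_delta_norm w1 mulr1 lexx.
  rewrite -[LHS]/(l1_fin N s (w *: l1_delta i)).
  by rewrite linearZ l1_fin_delta.
have := numerical_radius_ge cS st; rewrite S1 E.
rewrite -[X in `|X|]/(l1_fin N s a) sa normrM r1 mul1r ger0_norm//.
exact: sumr_ge0.
Qed.

(* The second component of [p] is the midpoint of two functions of the unit
   ball, one of which has modulus 1 at [x]; this gives [M <= (1 + M) / 2] for
   the supremum [M] of [`|(S p).2 x|] over the unit ball. *)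
Lemma prod_numerical_index_snd (S : {linear Xoo -> Xoo}) x (p : Xoo) :
  continuous S -> numerical_radius S = 1 -> `|p| <= 1 -> `|(S p).2 x| <= 1.
Proof.
move=> cS S1 p1.
have q_lin : linear (fun p : Xoo => (S p).2 x : K^o).
  by move=> c p' q'; rewrite linearP.
pose q := linear_of q_lin.
have cq : continuous q.
  have [M SM] : exists M, forall p, `|p| <= 1 -> `|S p| <= M.
    by move: cS => /linear_bounded_continuous/bounded_funP/(_ 1).
  apply/linear_bounded_continuous/bounded_funP => r.
  have /linear_bounded_continuous/bounded_funP/(_ r)[N SN] := cS.
  exists N => p' /SN; apply: le_trans.
  exact: le_trans (C0_pointwise_le _ x) (prod_norm_snd _).
have [ubq lbq] := opnorm_isLub cq.
suff : opnorm q <= 1 by apply: le_trans; apply: ubq; exists p.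
suff : opnorm q <= 2^-1 * (1 + opnorm q).
  rewrite mulrDr mulr1 -lerBlDr.
  have -> : opnorm q - 2^-1 * opnorm q = 2^-1 * opnorm q by field.
  by rewrite -{2}[2^-1]mulr1 ler_pM2l ?invr_gt0.
apply: lbq => _ [[u v] uv1 <-].
move: (uv1); rewrite /= prod_norm_le => /andP[/= u1 v1].
have [|//|f [f01 fx _]] := @C0_bump R k L L_locally_compact L_hausdorff x set0.
  exact: closed0.
have [s s1 vs] := norm_phase (v x).
have v01 z : 0 <= 1 - `|v z| <= 1.
  by rewrite subr_ge0 (le_trans (C0_pointwise_le v z))//= gerBl.
(* With [d = f (1 - |v|)], all [v + c d] with [|c| = 1] stay in the unit ball. *)
have [||d dE] := @C0_mul R k L f (fun z => 1 - `|v z|).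
- move=> z; apply: cvgB; first exact: cvg_cst.
  by apply: cvg_norm; exact: C0_continuous.
- by move=> z; have /andP[h0 h1] := v01 z; rewrite ger0_norm.
have vd (c : K) : `|c| = 1 -> `|v + c *: d| <= 1.
  move=> c1; apply: C0_norm_le => // z.
  rewrite -[(v + _) z]/(v z + c * d z) (le_trans (ler_normD _ _))//.
  rewrite normrM c1 mul1r dE/= normrM.
  have /andP[h0 h1] := v01 z; have /andP[f0 f1] := f01 z.
  by rewrite addrC -lerBrDr (ger0_norm f0) (ger0_norm h0) ler_piMl.
(* Of the two endpoints [v + s d] and [v - s d], only the first will be part of a state; the second
   is bounded by the norm of [q]. *)
have quv : q (u, v) = 2^-1 * (q (u, v + s *: d) + q (u, v + (- s) *: d)).
  rewrite -linearD (_ : _ + _ = (u, v) + (u, v)).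
  by rewrite linearD -mulr2n -[X in _ * X]mulr_natl mulKf ?pnatr_eq0.
  rewrite -[LHS]/((u + u, v + s *: d + (v + - s *: d)) : Xoo).
  by rewrite addrACA scaleNr subrr addr0.
rewrite -[leLHS]/(`|q (u, v)|) quv normrM normfV normr_nat ler_wpM2l//.
rewrite (le_trans (ler_normD _ _))// lerD//; last first.
  apply: ubq; exists (u, v + (- s) *: d) => //=.
  by rewrite prod_norm_le/= u1 vd// normrN.
have ev_lin : linear (fun h : C0 => s^-1 * h x : K^o).
  by move=> c h h'; rewrite /GRing.scale/= mulrDr mulrCA.
(* Evaluation at [x], rotated by [s^-1]: it is 1 at [v + s d], whose value at [x] is
   [s |v x| + s (1 - |v x|) = s]. *)
pose g := prod_inr_functional (linear_of ev_lin).
have gE a b : g (a, b) = s^-1 * b x by [].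
have g1 p' : `|g p'| <= `|p'|.
  case: p' => a b; rewrite gE normrM normfV s1 invr1 mul1r.
  exact: le_trans (C0_pointwise_le _ _) (prod_norm_snd (a, b)).
have s0 : s != 0 by rewrite -normr_eq0 s1 oner_eq0.
have st : states ((u, v + s *: d) : Xoo, g).
  apply: statesI => //; first by rewrite prod_norm_le/= u1 vd.
  rewrite gE -[(v + _) x]/(v x + s * d x) dE/= fx mul1r {1}vs -mulrDr.
  by rewrite addrC subrK mulr1 mulVf.
have := numerical_radius_ge cS st; rewrite S1.
by rewrite -[X in `|X|]/(s^-1 * q (u, v + s *: d)) normrM normfV s1 invr1 mul1r.
Qed.

Lemma not_BPBp_nu_prod : ~ BPBp_nu Xoo.
Proof.
have e1 : 4%:R^-1 < 1 :> K by rewrite invf_lt1 ?ltr1n ?ltr0n.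
move=> /(_ 4%:R^-1); rewrite invr_gt0 ltr0n => /(_ isT e1)[eta].
move=> /test_data[m [t [g [g0 g1 gt eta1]]]].
pose T := prod_op (test_op m g).
have T1 p : `|T p| <= `|p| by exact/prod_op_contraction/test_op_contraction.
pose x0' := prod_inr_functional (C0_mean m t).
have x0'1 p : `|x0' p| <= `|p|.
  have := @C0_mean_contraction R k L m t p.2.
  by move=> /le_trans; apply; exact: prod_norm_snd.
have tb1 := total_bump_le1 g0 g1.
(* The second component makes [x0'] equal to 1 at the point; the value of [T] depends on the first
   component alone. *)
move=> /(_ T (uniform_l1 m, total_bump m g) x0') [].
- exact: contraction_continuous.
- apply: statesI => //; last exact: C0_mean_total_bump.
  by rewrite prod_norm_le/= tb1 uniform_l1_norm lexx.
- pose f := prod_inr_functional (C0_eval (t 1)).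
  have f_le p : `|f p| <= `|p|.
    have := C0_pointwise_le p.2 (t 1).
    by move=> /le_trans; apply; exact: prod_norm_snd.
  apply: (@numerical_radius_max R k Xoo T ((l1_delta 0, total_bump m g), f)) => //.
    apply: statesI => //; last exact: (total_bump_t gt).
    by rewrite prod_norm_le/= tb1 l1_delta_norm lexx.
  rewrite -[X in `|X|]/(test_op m g (l1_delta 0) (t 1)).
  by rewrite l1_fin_delta// (punctured_t gt)// normr1.
- rewrite -[X in _ < `|X|]/(C0_mean m t (test_op m g (uniform_l1 m))).
  by rewrite (C0_mean_test_op gt).
move=> S [[u v] [x1' [[cS st S1 x1'S] [Se x1e x1'e]]]].
have [/= x1s x1's _] := st.
have /andP[/= u1 v1] : (`|(u, v).1| <= 1) && (`|(u, v).2| <= 1).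
  by rewrite -prod_norm_le x1s.
pose y := linear_of (prod_inr_linear x1').
apply: (@no_near_attainment _ _ _ m t g g0 g1 gt u y) => [|h h1|i ni ui0].
- rewrite (le_trans (uniform_l1_dist _ u))// ltW// (le_lt_trans _ x1e)//.
  exact: (prod_norm_fst (u - uniform_l1 m, v - total_bump m g)).
- have := opnorm_sub_lt ((0, h) : Xoo) x1's.1 (contraction_continuous x0'1) x1'e.
  move=> /le_trans; apply; rewrite ler_piMr//.
  by rewrite prod_norm_le/= normr0 ler01.
set w := u i / `|u i|; set z : Xoo := (w *: l1_delta i, v).
have w1 : `|w| = 1 by rewrite norm_sg.
have z1 : `|z| <= 1 by rewrite prod_norm_le/= normrZ l1_delta_norm mulr1 w1 lexx.
have ui1 : `|u i| <= 1 by rewrite (le_trans (l1_coord_le u i)).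
(* Here [v] is kept in [z] and only scaled in the remainder, as the maximum norm permits. *)
have [||||x1'z x1'Sz] := @state_face _ _ _ S x1' ((u, v) : Xoo) z
    ((u - u i *: l1_delta i, (1 - `|u i|) *: v) : Xoo) `|u i| cS S1 st x1'S _ _ _ _.
- by rewrite normr_gt0.
- rewrite -[RHS]/((`|u i| *: (w *: l1_delta i) + (u - u i *: l1_delta i),
      `|u i| *: v + (1 - `|u i|) *: v) : Xoo).
  by rewrite -l1_split -scalerDl addrC subrK scale1r.
- by [].
- rewrite prod_norm_le/= (le_trans (l1_sub_coord_norm _ _)) ?lerD2r//=.
  by rewrite normrZ ger0_norm ?subr_ge0// ler_piMr ?subr_ge0.
have := prod_numerical_index_fst i cS S1 w1 v1; rewrite -/z.
have := prod_numerical_index_snd _ cS S1 z1.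
case Sz : (S z) => [a b] /= b1 a1.
(* As [|a| <= 1] is known, the maximum norm of [S z + (0, h)] only requires a bound on [b + h]. *)
exists (x1' (S z)), (fun x => `|b x|); split=> //.
- by move=> x; apply: cvg_norm; exact: C0_continuous.
- by move=> x; rewrite normr_ge0/=.
- have := opnorm_sub_lt z cS (contraction_continuous T1) Se.
  rewrite Sz => /(le_trans (prod_norm_snd _)).
  rewrite -[X in `|X|]/(b - test_op m g (w *: l1_delta i)).
  move=> /(le_trans (C0_pointwise_le _ (t i))).
  rewrite -[X in `|X|]/(b (t i) - test_op m g (w *: l1_delta i) (t i)).
  by rewrite (test_op_delta_t gt)// subr0 => /le_trans; apply; rewrite ler_piMr.
- move=> h hb.
  rewrite -[leLHS]/(`|x1' (S z) + x1' ((0, h) : Xoo)|) -linearD Sz.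
  rewrite (le_trans (dual_sphere_le _ x1's))//.
  rewrite -[X in `|X|]/((a + 0, b + h) : Xoo) addr0 prod_norm_le/= a1/=.
  apply: C0_norm_le => // x.
  by rewrite (le_trans (ler_normD _ _))// addrC -lerBrDr hb.
Qed.

End main.

Theorem corollary3p6 (R : realType) (k : scalar_kind) (L : topologicalType)
    (L_infinite : infinite_set [set: L]%classic)
    (L_locally_compact : locally_compact [set: L]%classic)
    (L_hausdorff : hausdorff_space L) :
  [/\ ~ BPBZp (l1 R k) (C0 R k L),
      ~ BPBp_nu (sum1 (l1 R k) (C0 R k L)) &
      ~ BPBp_nu (l1 R k * C0 R k L)%type].
Proof.
by split; [exact: not_BPBZp|exact: not_BPBp_nu_sum1|exact: not_BPBp_nu_prod].
Qed.
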